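(* For $n\ge 1$ and $i,e\ge 0$ let $f(\mathfrak{S}_n,i,e)$ be the number of Boolean involutions in $\mathfrak{S}_n$ with $i$ inversions and $e$ excedances, and define the generating function $$F(x,y,z)=\sum_{n\ge 1,\ i\ge 0,\ e\ge 0}f(\mathfrak{S}_n,i,e)\,x^ny^iz^e.$$ Then $$F(x,y,z)=\frac{x^2yz+x-x^2y^2-x^3y^3z}{1-x-x^2yz-xy^2+x^2y^2-x^2y^3z+x^3y^3z}.$$
   Context: $\mathfrak{S}_n$ is the group of permutations of $[n]=\{1,\dots,n\}$; an inversion of $\pi$ is a pair $(i,j)$ with $i<j$ and $\pi(i)>\pi(j)$; an excedance of $\pi$ is an index $i$ with $\pi(i)>i$. $\mathcal{I}(\mathfrak{S}_n)$ is the set of involutions (elements of order at most two, including the identity). For $w\in\mathcal{I}(\mathfrak{S}_n)$, let $B(w)=\{u\in\mathcal{I}(\mathfrak{S}_n):u\le w\}$, ordered by the restriction of the (strong) Bruhat order $\le$ on $\mathfrak{S}_n$ (Coxeter generators: adjacent transpositions); $w$ is Boolean if $B(w)$ is isomorphic to a Boolean lattice. The identity is one of formal power series. *)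

(* Defs.v *)
From HB Require Import structures.
From mathcomp Require Import all_boot all_order all_algebra all_fingroup.
From mathcomp Require Import boolp zify.

Set Implicit Arguments.
Unset Strict Implicit.
Unset Printing Implicit Defensive.

Import GRing.Theory.

Local Open Scope ring_scope.

(** Univariate formal power series.  R[[x, y, z]] is obtained by iteration, as
    R[[z]][[y]][[x]].  The type is a record because [nat -> R] already carries
    the pointwise ring structure in some libraries. *)

Record fps (R : Type) := Fps { fpscoef : nat -> R }.

Section FpsRing.
Variable R : comNzRingType.
Implicit Types a b c : fps R.

HB.instance Definition _ := gen_eqMixin (fps R).
HB.instance Definition _ := gen_choiceMixin (fps R).

Lemma fpsP a b : fpscoef a =1 fpscoef b -> a = b.
Proof. by case: a b => [a] [b] /= /funext ->. Qed.

Definition fps_zero : fps R := Fps (fun=> 0).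
Definition fps_opp a : fps R := Fps (fun n => - fpscoef a n).
Definition fps_add a b : fps R := Fps (fun n => fpscoef a n + fpscoef b n).

Fact fps_addA : associative fps_add.
Proof. by move=> a b c; apply: fpsP => n; apply: addrA. Qed.
Fact fps_addC : commutative fps_add.
Proof. by move=> a b; apply: fpsP => n; apply: addrC. Qed.
Fact fps_add0 : left_id fps_zero fps_add.
Proof. by move=> a; apply: fpsP => n; apply: add0r. Qed.
Fact fps_addN : left_inverse fps_zero fps_opp fps_add.
Proof. by move=> a; apply: fpsP => n; apply: addNr. Qed.

HB.instance Definition _ :=
  GRing.isZmodule.Build (fps R) fps_addA fps_addC fps_add0 fps_addN.

Definition fps_const (r : R) : fps R := Fps (fun n => if n is 0 then r else 0).
Definition fps_var : fps R := Fps (fun n => if n is 1 then 1 else 0).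
Definition fps_mul a b : fps R :=
  Fps (fun n => \sum_(i < n.+1) fpscoef a i * fpscoef b (n - i)%N).

Let trunc N a : {poly R} := \poly_(i < N) fpscoef a i.

Let coef_trunc N a n : (n < N)%N -> (trunc N a)`_n = fpscoef a n.
Proof. by move=> ltnN; rewrite coef_poly ltnN. Qed.

Let coef_trunc_mul N a b n : (n < N)%N ->
  fpscoef (fps_mul a b) n = (trunc N a * trunc N b)`_n.
Proof.
move=> ltnN; rewrite coefM; apply: eq_bigr => i _.
rewrite !coef_trunc //; first by rewrite (leq_ltn_trans _ ltnN) ?leq_subr.
by rewrite (leq_ltn_trans _ ltnN) // -ltnS.
Qed.

Fact fps_mulC : commutative fps_mul.
Proof.
by move=> a b; apply: fpsP => n; rewrite !(coef_trunc_mul _ _ (ltnSn n)) mulrC.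
Qed.

Fact fps_mulA : associative fps_mul.
Proof.
move=> a b c; apply: fpsP => n.
transitivity (trunc n.+1 a * (trunc n.+1 b * trunc n.+1 c))`_n.
  rewrite coefM; apply: eq_bigr => i _; rewrite coef_trunc //.
  by rewrite -coef_trunc_mul // ltnS leq_subr.
rewrite mulrA coefM; apply: eq_bigr => i _.
by rewrite -coef_trunc_mul // coef_trunc // ltnS leq_subr.
Qed.

Fact fps_mul1 : left_id (fps_const 1) fps_mul.
Proof.
move=> a; apply: fpsP => n /=; rewrite big_ord_recl /= mul1r subn0.
by rewrite big1 ?addr0 // => i _; rewrite mul0r.
Qed.

Fact fps_mulDl : left_distributive fps_mul +%R.
Proof.
move=> a b c; apply: fpsP => n /=; rewrite -big_split.
by apply: eq_bigr => i _; rewrite mulrDl.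
Qed.

Fact fps_1neq0 : fps_const 1 != 0 :> fps R.
Proof.
apply/eqP => /(congr1 (fun a => fpscoef a 0)) /= /eqP.
by rewrite oner_eq0.
Qed.

HB.instance Definition _ := GRing.Zmodule_isComNzRing.Build (fps R)
  fps_mulA fps_mulC fps_mul1 fps_mulDl fps_1neq0.

Definition fps_unit : {pred fps R} := fun a => `[< exists b, b * a = 1 >].
Definition fps_inv a : fps R :=
  if pselect (exists b, b * a = 1) is left e then projT1 (cid e) else a.

Fact fps_mulV : {in fps_unit, left_inverse 1 fps_inv *%R}.
Proof.
move=> a /asboolP ua; rewrite /fps_inv.
by case: pselect => // e; case: (cid e).
Qed.
Fact fps_unitPl a b : b * a = 1 -> fps_unit a.
Proof. by move=> ba; apply/asboolP; exists b. Qed.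
Fact fps_inv_out : {in [predC fps_unit], fps_inv =1 id}.
Proof.
move=> a /negP ua; rewrite /fps_inv.
by case: pselect => // e; case: ua; apply/asboolP.
Qed.

HB.instance Definition _ := GRing.ComNzRing_hasMulInverse.Build (fps R)
  fps_mulV fps_unitPl fps_inv_out.

End FpsRing.

(** Hence a series over an iterated power series ring is invertible as soon as
    its constant term is. *)
Lemma fps_const_unit (R : comUnitRingType) (a : fps R) :
  fpscoef a 0 \is a GRing.unit -> a \is a GRing.unit.
Proof.
move=> ua; pose u := fpscoef a 0.
pose next (s : seq R) := rcons s
  (u^-1 * ((size s == 0)%:R - \sum_(i < size s) s`_i * fpscoef a (size s - i)%N)).
pose s n := iter n next [::].
have size_s n : size (s n) = n by elim: n => //= n IH; rewrite size_rcons IH.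
have sE m i : (i < m)%N -> (s m)`_i = (s i.+1)`_i.
  elim: m => // m IH; rewrite ltnS leq_eqVlt => /predU1P[-> //|lt_im].
  by rewrite /= nth_rcons size_s lt_im IH.
apply/asboolP; exists (Fps (fun n => (s n.+1)`_n)); apply: fpsP => n /=.
rewrite big_ord_recr /= subnn nth_rcons size_s ltnn eqxx mulrAC mulVr // mul1r.
rewrite (eq_bigr (fun i : 'I_n => (s n)`_i * fpscoef a (n - i)%N)); last first.
  by move=> i _; rewrite [in RHS]sE.
by rewrite addrC subrK; case: n.
Qed.

Notation fps3 R := (fps (fps (fps R))).

Section Fps3.
Variable R : comNzRingType.

Definition fps3_of (a : nat -> nat -> nat -> R) : fps3 R :=
  Fps (fun n => Fps (fun i => Fps (fun e => a n i e))).
Definition varx : fps3 R := fps_var (fps (fps R)).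
Definition vary : fps3 R := fps_const (fps_var (fps R)).
Definition varz : fps3 R := fps_const (fps_const (fps_var R)).

End Fps3.

(** Permutations: [n] is represented by 'I_n = {0, ..., n-1}; inversions,
    excedances and adjacent transpositions are invariant under the shift. *)

Definition inversions n (w : 'S_n) : {set 'I_n * 'I_n} :=
  [set p : 'I_n * 'I_n | (p.1 < p.2)%N && (w p.2 < w p.1)%N].

Definition excedances n (w : 'S_n) : {set 'I_n} := [set i : 'I_n | (i < w i)%N].

Definition involutions n : {set 'S_n} := [set w | (#[w]%g <= 2)%N].

Definition simples n : {set 'S_n} :=
  [set tperm p.1 p.2 | p : 'I_n * 'I_n & p.2 == p.1.+1 :> nat].

Definition has_word n (w : 'S_n) (k : nat) : bool :=
  [exists c : {ffun 'I_k -> 'S_n},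
     [forall i, c i \in simples n] && (w == \prod_(i < k) c i)%g].

Lemma tperm_gen_simples n d (i j : 'I_n) :
  j = (i + d)%N :> nat -> tperm i j \in <<simples n>>%g.
Proof.
elim: d j => [|d IHd] j; rewrite ?addn0 ?addnS => def_j.
  by rewrite (val_inj def_j) tperm1 group1.
have ltkn : (i + d < n)%N by rewrite (leq_trans _ (ltn_ord j)) // def_j.
pose k := Ordinal ltkn.
have Skj : tperm k j \in <<simples n>>%g.
  by apply/mem_gen/imsetP; exists (k, j); rewrite // inE /= def_j.
have [-> | neq_ik] := eqVneq i k; first exact: Skj.
have neq_ij : i != j.
  by apply/eqP => /(congr1 val) /= eq_ij; move: def_j; rewrite -eq_ij; lia.
rewrite (_ : tperm i j = tperm i k ^ tperm k j)%g.
  by rewrite groupJ ?IHd.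
by rewrite tpermJ tpermL tpermD // eq_sym.
Qed.

Lemma gen_simples n : <<simples n>>%g = [set: 'S_n].
Proof.
apply/eqP; rewrite eqEsubset subsetT; apply/subsetP => w _.
have [ts -> _] := prod_tpermP w.
elim/big_ind: _ => [|u v Gu Gv|[i j] _]; rewrite ?group1 ?groupM //=.
have [le_ij | /ltnW le_ji] := leqP i j.
  by rewrite (@tperm_gen_simples _ (j - i)) // subnKC.
by rewrite tpermC (@tperm_gen_simples _ (i - j)) // subnKC.
Qed.

Fact has_word_ex n (w : 'S_n) : exists k, has_word w k.
Proof.
have /gen_prodgP[k [c Sc ->]]: w \in <<simples n>>%g by rewrite gen_simples inE.
exists k; apply/existsP; exists (finfun c); apply/andP; split.
  by apply/forallP => i; rewrite ffunE.
by apply/eqP/eq_bigr => i _; rewrite ffunE.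
Qed.

Definition cox_length n (w : 'S_n) : nat := ex_minn (has_word_ex w).

Definition reflections n : {set 'S_n} :=
  class_support (simples n) [set: 'S_n].

Definition bruhat_step n : rel 'S_n := fun u w =>
  [exists t in reflections n, w == (u * t)%g] && (cox_length u < cox_length w)%N.

(** [connect] is the reflexive transitive closure. *)
Definition bruhat n : rel 'S_n := connect (@bruhat_step n).

Definition lower_involutions n (w : 'S_n) : {set 'S_n} :=
  [set u in involutions n | bruhat u w].

(** B(w) is isomorphic, as a poset, to the lattice of subsets of a k-set. *)
Definition is_boolean n (w : 'S_n) : Prop :=
  exists (k : nat) (f : 'S_n -> {set 'I_k}),
    [/\ {in lower_involutions w &, injective f},
        f @: lower_involutions w = [set: {set 'I_k}] &
        {in lower_involutions w &, forall u v, bruhat u v = (f u \subset f v)}].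

Definition nb_boolean (n i e : nat) : nat :=
  #|[set w in involutions n | [&& `[< is_boolean w >],
       #|inversions w| == i & #|excedances w| == e]]|.

Definition boolean_gf : fps3 int :=
  fps3_of (fun n i e => if (1 <= n)%N then (nb_boolean n i e)%:Z else 0).

(* Main.v *)
(** Write [s * w * s], or [s * w] when [s] commutes with [w], for the action of a
simple transposition [s] on an involution [w].  Each such step changes
[inv w + exc w] by 2, so [(inv w + exc w) / 2] is the number of letters of a
reduced word of [w] for this action, and it is at least the size of the support
of [w], the set of simple transpositions below [w].

An involution is Boolean iff equality holds.  If [B(w)] is Boolean of rank [k],
a reduced word gives a chain of length [(inv w + exc w) / 2 <= k], while the [k]
atoms are distinct simple transpositions of the support.  Conversely, if the
letters of a reduced word are distinct, the lifting property shows by induction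
that taking supports is an isomorphism from [B(w)] onto the subsets of the
support of [w].

Let [a_n] be the sum of [y^inv z^exc] over the Boolean involutions of [n] points
and write [p, q, r] for the last three points.  A Boolean involution moving [r]
either exchanges [q] and [r] (contribution [y z a_(n-2)]), or fixes [q]
(conjugating by the transposition [q r] gives [y^2 (a_(n-1) - a_(n-2))]), or maps
[r] to [p] (conjugating by [p q] and removing [q r] gives
[y^3 z (a_(n-2) - a_(n-3))]).  The resulting linear recurrence is the stated
identity. *)
Require Import Defs.
From mathcomp Require Import all_boot all_order all_algebra all_fingroup.
From mathcomp Require Import cyclic boolp zify ring.

Set Implicit Arguments.
Unset Strict Implicit.
Unset Printing Implicit Defensive.

Import GRing.Theory.
Local Open Scope ring_scope.

(** * Coxeter length and inversions *)

Section Length.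
Local Open Scope nat_scope.
Local Open Scope group_scope.
Variable n : nat.
Implicit Types (i j a b c p q : 'I_n) (u v w : 'S_n).

Lemma val_tperm i j a :
  tperm i j a = (if a == i :> nat then j else if a == j :> nat then i else a)
    :> nat.
Proof.
case: tpermP => [->|->|nai naj]; rewrite ?eqxx //.
  by case: eqP => [e|//]; rewrite e.
by case: eqP => [/val_inj //|_]; case: eqP => [/val_inj //|_].
Qed.

(** No point lies strictly between [i] and [j], so exchanging them can reverse no pair other than
    [(i, j)] itself. *)
Lemma tperm_adj_lt i j a b : j = i.+1 :> nat -> (a < b)%N ->
  ~~ ((a == i) && (b == j)) -> (tperm i j a < tperm i j b)%N.
Proof.
move=> ij ltab; rewrite -!val_eqE !val_tperm /= => nab.
by repeat case: ifP => /eqP; lia.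
Qed.

(** Products act from left to right, so [tperm i j * w] exchanges the entries of [w] at positions
    [i] and [j]. The map [g] carries the inversions of [w] to those of the product, and [(i, j)] is
    the only new one. *)
Lemma card_inversions_asc i j w : j = i.+1 :> nat -> (w i < w j)%N ->
  #|inversions (tperm i j * w)| = #|inversions w|.+1.
Proof.
move=> ij asc.
pose g (e : 'I_n * 'I_n) := (tperm i j e.1, tperm i j e.2).
have gK : involutive g by case=> a b; rewrite /g /= !tpermK.
have -> : inversions (tperm i j * w) = (i, j) |: g @^-1: inversions w.
  apply/setP=> -[a b]; rewrite !inE xpair_eqE /= !permM.
  case: (boolP ((a == i) && (b == j))) => [/andP[/eqP-> /eqP->]|nab] /=.
    by rewrite tpermL tpermR asc ij ltnSn.
  case: (boolP ((a == j) && (b == i))) => [/andP[/eqP-> /eqP->]|nba] /=.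
    by rewrite tpermL tpermR; lia.
  case: ltngtP => [ltab|ltba|/val_inj->].
  - by rewrite tperm_adj_lt.
  - have := tperm_adj_lt ij ltba; rewrite andbC => /(_ nba).
    by case: (ltngtP (tperm i j b)).
  - by rewrite !ltnn.
rewrite cardsU1 !inE /g /= tpermL tpermR ij ltnNge leqnSn /= add1n.
by rewrite on_card_preimset //; apply/onW_bij/inv_bij.
Qed.

Lemma tperm_mulK i j w : tperm i j * (tperm i j * w) = w.
Proof. by rewrite mulgA tperm2 mul1g. Qed.

Lemma card_inversions_desc i j w : j = i.+1 :> nat -> (w j < w i)%N ->
  #|inversions w| = #|inversions (tperm i j * w)|.+1.
Proof.
move=> ij desc; rewrite -(card_inversions_asc ij) ?tperm_mulK //.
by rewrite !permM tpermL tpermR.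
Qed.

Lemma perm_ltNge w a b : a != b -> (w a < w b)%N = ~~ (w b < w a)%N.
Proof.
move=> nab; rewrite -leqNgt ltn_neqAle andb_idl // => _.
by rewrite val_eqE (inj_eq perm_inj).
Qed.

Lemma adj_neq i j : j = i.+1 :> nat -> i != j.
Proof. by move=> ij; rewrite -val_eqE /= ij; lia. Qed.

Lemma adj_lt i j : j = i.+1 :> nat -> (i < j)%N.
Proof. by move=> ->. Qed.

Lemma adj_gtF i j : j = i.+1 :> nat -> (j < i)%N = false.
Proof. by move=> ->; rewrite ltnNge leqnSn. Qed.

(** Induction on [q - p] with [(p q) = (p r) (r q) (p r)] and [r = p + 1]. The middle factor adds
    inversions by induction, and each outer factor changes their number by one. Both outer factors
    cannot lose: if the last one does, then [w p < w q < w r], so the first one gains. *)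
Lemma ltn_inversions p q w : (p < q)%N -> (w p < w q)%N ->
  (#|inversions w| < #|inversions (tperm p q * w)|)%N.
Proof.
have [d] := ubnP (q - p); elim: d => // d IHd in p w * => led ltpq ltw.
have [pq|npq] := eqVneq (q : nat) p.+1; first by rewrite card_inversions_asc.
have ltrn : (p.+1 < n)%N by have := ltn_ord q; lia.
pose r := Ordinal ltrn; have pr : r = p.+1 :> nat by [].
have nrq : r != q by rewrite -val_eqE /= eq_sym.
have npq' : p != q by rewrite -val_eqE /=; lia.
have def_t : tperm p q * w = tperm p r * (tperm r q * (tperm p r * w)).
  rewrite -{1}(tpermR p r) -{1}[q](@tpermD _ p r) // -tpermJ conjgE tpermV.
  by rewrite !mulgA.
set x := tperm p r * w in def_t *; set y := tperm r q * x in def_t *.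
have xr : x r = w p by rewrite permM tpermR.
have xq : x q = w q by rewrite permM tpermD // -val_eqE /=; lia.
have xp : x p = w r by rewrite permM tpermL.
have ltxy : (#|inversions x| < #|inversions y|)%N.
  by apply: IHd; rewrite ?xr ?xq //=; lia.
have yr : y r = w q by rewrite permM tpermL.
have yp : y p = w r by rewrite permM tpermD //; rewrite -val_eqE /=; lia.
rewrite def_t; have wx : w = tperm p r * x by rewrite tperm_mulK.
have [ascy|descy] := boolP (y p < y r)%N.
  rewrite (card_inversions_asc pr ascy) ltnS (leq_trans _ ltxy) //.
  have [ascw|descw] := boolP (w p < w r)%N.
    by rewrite /x (card_inversions_asc pr ascw) ltnW // ltnS.
  by rewrite (@card_inversions_desc p r w pr) // perm_ltNge // eq_sym adj_neq.
have descy' : (y r < y p)%N by rewrite perm_ltNge // eq_sym adj_neq.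
have ascw : (w p < w r)%N by move: descy'; rewrite yr yp; lia.
have := card_inversions_asc pr ascw; have := card_inversions_desc pr descy'.
by rewrite -/x; lia.
Qed.

Lemma card_inversionsV w : #|inversions w^-1| = #|inversions w|.
Proof.
pose f (v : 'S_n) (e : 'I_n * 'I_n) := (v e.2, v e.1).
have f_inj v : injective (f v).
  by move=> [a b] [c d] [/perm_inj-> /perm_inj->].
have le v : (#|inversions v| <= #|inversions v^-1|)%N.
  rewrite -(card_imset _ (f_inj v)); apply/subset_leq_card/subsetP => e.
  case/imsetP=> -[a b]; rewrite inE => /andP[/= ltab ltv] ->.
  by rewrite inE /= !permK ltv.
by apply/eqP; rewrite eqn_leq le -{2}(invgK w) le.
Qed.

Lemma inversions1 : inversions (1 : 'S_n) = set0.
Proof. by apply/setP=> -[a b]; rewrite !inE !perm1 /=; case: ltngtP. Qed.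

(** An increasing permutation satisfies [a <= w a] everywhere; its inverse is increasing too, which
    gives the opposite inequality. *)
Lemma asc_perm1 w :
  (forall i j, j = i.+1 :> nat -> (w i < w j)%N) -> w = 1.
Proof.
have mono (v : 'S_n) : {homo v : a b / (a < b)%N} -> forall a, (a <= v a)%N.
  move=> mv [m]; elim: m => //= m IHm ltmn.
  apply: (leq_ltn_trans (IHm (ltnW ltmn))).
  by rewrite (mv (Ordinal (ltnW ltmn))) /=.
move=> asc; have mw : {homo w : a b / (a < b)%N}.
  move=> a b; have [d] := ubnP (b - a); elim: d => // d IHd in b * => led ltab.
  have [/asc //|nab] := eqVneq (b : nat) a.+1.
  have ltbn : (b.-1 < n)%N by have := ltn_ord b; lia.
  have := IHd (Ordinal ltbn); have := asc (Ordinal ltbn) b; rewrite /=; lia.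
have mwV : {homo w^-1 : a b / (a < b)%N}.
  move=> a b; case: (ltngtP (w^-1 a) (w^-1 b)) => //.
    by move=> /mw; rewrite !permKV; lia.
  by move=> /val_inj/perm_inj->; rewrite ltnn.
apply/permP=> a; apply: val_inj; rewrite perm1; apply/eqP.
by rewrite eqn_leq mono // -{2}(permK w a) mono.
Qed.

Lemma desc_ex w : w != 1 -> exists i j, j = i.+1 :> nat /\ (w j < w i)%N.
Proof.
move=> nw1; pose d := [exists p : 'I_n * 'I_n,
  (p.2 == p.1.+1 :> nat) && (w p.2 < w p.1)%N].
have [/existsP[[i j] /andP[/eqP ij lt]]|nd] := boolP d; first by exists i, j.
case/eqP: nw1; apply: asc_perm1 => i j ij; move: nd; rewrite negb_exists.
move=> /forallP/(_ (i, j)) /=; rewrite ij eqxx /=.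
by rewrite (perm_ltNge _ (adj_neq ij)).
Qed.

Lemma simplesP s :
  reflect (exists i j, j = i.+1 :> nat /\ s = tperm i j) (s \in simples n).
Proof.
apply: (iffP imsetP) => [[[i j]] | [i [j [ij ->]]]].
  by rewrite inE => /eqP ij ->; exists i, j.
by exists (i, j); rewrite // inE ij.
Qed.

Lemma has_word1 : has_word (1 : 'S_n) 0.
Proof.
apply/existsP; exists [ffun=> 1]; rewrite big_ord0 eqxx andbT.
by apply/forallP=> -[].
Qed.

Lemma has_wordM s w k : s \in simples n -> has_word w k ->
  has_word (s * w) k.+1.
Proof.
move=> ss /existsP[f /andP[/forallP sf /eqP->]]; apply/existsP.
exists [ffun i => if unlift ord0 i is Some i' then f i' else s].
rewrite big_ord_recl ffunE unlift_none; apply/andP; split.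
  by apply/forallP=> i; rewrite ffunE; case: unliftP.
by apply/eqP; congr (_ * _); apply: eq_bigr => i _; rewrite ffunE liftK.
Qed.

(** Removing descents one at a time sorts [w], and each removal costs exactly one inversion. *)
Lemma has_word_inversions w : has_word w #|inversions w|.
Proof.
have [m] := ubnP #|inversions w|; elim: m => // m IHm in w * => ltm.
have [->|/desc_ex[i [j [ij desc]]]] := eqVneq w 1.
  by rewrite inversions1 cards0 has_word1.
rewrite (card_inversions_desc ij desc) -{1}(tperm_mulK i j w) has_wordM //.
  by apply/simplesP; exists i, j.
by apply: IHm; move: ltm; rewrite (card_inversions_desc ij desc).
Qed.

Lemma leq_inversions_word w k : has_word w k -> (#|inversions w| <= k)%N.
Proof.
case/existsP=> f /andP[/forallP sf /eqP->].
elim: k f sf => [|k IHk] f sf; first by rewrite big_ord0 inversions1 cards0.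
rewrite big_ord_recl /=; set v := \prod_(_ < _) _.
have lev : (#|inversions v| <= k)%N.
  have := IHk [ffun i => f (lift ord0 i)]; rewrite /v.
  under eq_bigr do rewrite ffunE.
  by apply=> i; rewrite ffunE.
have /simplesP[i [j [ij ->]]] := sf ord0.
have [asc|] := boolP (v i < v j)%N; first by rewrite card_inversions_asc.
rewrite -leqNgt leq_eqVlt val_eqE (inj_eq perm_inj) eq_sym (negPf (adj_neq ij)).
move=> /= desc; rewrite ltnW // ltnS (leq_trans _ lev) //.
by rewrite (card_inversions_desc ij desc).
Qed.

Lemma cox_lengthE w : cox_length w = #|inversions w|.
Proof.
rewrite /cox_length; case: ex_minnP => k /leq_inversions_word lek min_k.
by apply/eqP; rewrite eqn_leq lek min_k // has_word_inversions.
Qed.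

End Length.

(** * Bruhat order and involutions *)

Section Bruhat.
Local Open Scope nat_scope.
Local Open Scope group_scope.
Variable n : nat.
Implicit Types (i j a b c p q : 'I_n) (u v w : 'S_n).

Lemma reflections_tperm p q : p != q -> tperm p q \in reflections n.
Proof.
move=> npq.
(* A descent of [tperm p q] supplies an adjacent pair [i, j]. The conjugating element moves [i] to
   [p], and then the image [k] of [j] to [q]. *)
have [i [j [ij _]]] :
    exists i j, j = i.+1 :> nat /\ (tperm p q j < tperm p q i)%N.
  apply: desc_ex; apply/eqP => /(congr1 (fun t : 'S_n => t p)).
  by rewrite tpermL perm1 => /eqP; rewrite eq_sym (negPf npq).
pose k := tperm i p j.
have npk : p != k by rewrite /k -{1}(tpermL i p) (inj_eq perm_inj) adj_neq.
apply/imset2P; exists (tperm i j) (tperm i p * tperm k q); rewrite ?inE //.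
  by apply/simplesP; exists i, j.
by rewrite tpermJ !permM tpermL -/k tpermL tpermD // eq_sym.
Qed.

Lemma reflectionsP t :
  reflect (exists p q, p != q /\ t = tperm p q) (t \in reflections n).
Proof.
apply: (iffP idP) => [/imset2P[s x /simplesP[i [j [ij ->]]] _ ->]|]; last first.
  by case=> p [q [npq ->]]; apply: reflections_tperm.
by exists (x i), (x j); rewrite tpermJ (inj_eq perm_inj) adj_neq.
Qed.

(** A reflection on the right exchanges two values, which is the same as exchanging two positions on
    the left. By [ltn_inversions] the length grows exactly when the entries at these positions are
    in order. *)
Lemma bruhat_stepP u w :
  reflect (exists p q, [/\ (p < q)%N, (u p < u q)%N & w = tperm p q * u])
          (bruhat_step u w).
Proof.
apply: (iffP andP) => [[/existsP[t /andP[rt /eqP wE]]]|[p [q [ltpq ltu ->]]]].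
  case/reflectionsP: rt wE => a [b [nab ->]].
  wlog ltab : a b nab / (u^-1 a < u^-1 b)%N => [wl|] wE ltl.
    have [/wl/(_ wE ltl) //|] := boolP (u^-1 a < u^-1 b)%N; first exact.
    rewrite -perm_ltNge 1?eq_sym // => /wl; rewrite tpermC; apply=> //.
    by rewrite eq_sym.
  exists (u^-1 a), (u^-1 b); have {}wE : w = tperm (u^-1 a) (u^-1 b) * u.
    by rewrite conjgC tpermJ !permKV.
  split=> //; rewrite perm_ltNge; last by rewrite (inj_eq perm_inj).
  rewrite wE in ltl; apply: contraL ltl => ltu; rewrite -leqNgt ltnW //.
  have := @ltn_inversions n _ _ w ltab; rewrite wE tperm_mulK !cox_lengthE.
  by apply; rewrite !permM tpermL tpermR.
have npq : p != q by rewrite -val_eqE /= ltn_eqF.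
split; last by rewrite !cox_lengthE ltn_inversions.
apply/existsP; exists (tperm (u p) (u q)).
by rewrite reflections_tperm ?(inj_eq perm_inj) // conjgC tpermJ eqxx.
Qed.

(** Multiplication by [(i j)] conjugates the reflection of the step and keeps its two positions in
    order, unless that reflection is [(i j)] itself. *)
Lemma bruhat_stepM i j u w : j = i.+1 :> nat -> bruhat_step u w ->
  w = tperm i j * u \/ bruhat_step (tperm i j * u) (tperm i j * w).
Proof.
move=> ij /bruhat_stepP[p [q [ltpq ltu ->]]].
have [/andP[/eqP-> /eqP->]|npq] := boolP ((p == i) && (q == j)); first by left.
right; apply/bruhat_stepP; exists (tperm i j p), (tperm i j q).
rewrite !permM !tpermK tperm_adj_lt //; split=> //.
by rewrite -tpermJ conjgE tpermV -!mulgA tperm_mulK.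
Qed.

Lemma bruhat_refl w : bruhat w w. Proof. exact: connect0. Qed.

Lemma bruhat_trans v u w : bruhat u v -> bruhat v w -> bruhat u w.
Proof. exact: connect_trans. Qed.

Lemma bruhat_leq_inversions u w : bruhat u w ->
  (u == w) || (#|inversions u| < #|inversions w|)%N.
Proof.
case/connectP=> s; elim: s u => [u _ ->|v s IHs u /=]; first by rewrite eqxx.
case/andP=> /andP[_]; rewrite !cox_lengthE => ltuv /IHs le /le{le} /orP[/eqP<-|].
  by rewrite ltuv orbT.
by move=> ltvw; rewrite (ltn_trans ltuv ltvw) orbT.
Qed.

Lemma bruhat_anti u w : bruhat u w -> bruhat w u -> u = w.
Proof.
move=> /bruhat_leq_inversions/orP[/eqP //|lt].
by move=> /bruhat_leq_inversions/orP[/eqP //|]; rewrite ltnNge ltnW.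
Qed.

Lemma bruhat_homo (f : 'S_n -> 'S_n) :
  (forall u w, bruhat_step u w -> bruhat (f u) (f w)) ->
  forall u w, bruhat u w -> bruhat (f u) (f w).
Proof.
move=> fP u w /connectP[s]; elim: s u => [u _ ->|v s IHs u /=].
  exact: bruhat_refl.
by case/andP=> /fP le1 /IHs le2 /le2; apply: bruhat_trans.
Qed.

Lemma bruhatV u w : bruhat u w -> bruhat u^-1 w^-1.
Proof.
apply: bruhat_homo => {w u} u w /bruhat_stepP[p [q [ltpq ltu ->]]].
apply/connect1/bruhat_stepP; exists (u p), (u q); split=> //.
  by rewrite !permK.
by rewrite invMg tpermV -tpermJ conjgE -!mulgA mulgV mulg1.
Qed.

(** The longer ([hl]) and the shorter ([ll]) of [w] and [tperm i j * w], for adjacent [i] and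
    [j]. *)
Definition hl i j w := if (w i < w j)%N then tperm i j * w else w.
Definition ll i j w := if (w i < w j)%N then w else tperm i j * w.

Section Simple.
Variables i j : 'I_n.
Hypothesis ij : j = i.+1 :> nat.
Let s := tperm i j.

Lemma perm_leqNgt w : ~~ (w i < w j)%N = (w j < w i)%N.
Proof. by rewrite -perm_ltNge // eq_sym adj_neq. Qed.

Lemma asc_bruhat w : (w i < w j)%N -> bruhat w (s * w).
Proof.
by move=> asc; apply/connect1/bruhat_stepP; exists i, j; rewrite adj_lt.
Qed.

Lemma desc_bruhat w : (w j < w i)%N -> bruhat (s * w) w.
Proof.
move=> desc; rewrite -{2}(tperm_mulK i j w); apply: asc_bruhat.
by rewrite !permM tpermL tpermR.
Qed.

(** This is the lifting property. By [bruhat_stepM] either [u] and [w] form one coset of [s], and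
    both sides agree, or [s * u <= s * w]. In the second case the ascent or descent of each element
    at [i] completes the chain. *)
Lemma bruhat_hl_ll u w : bruhat_step u w ->
  bruhat (hl i j u) (hl i j w) /\ bruhat (ll i j u) (ll i j w).
Proof.
move=> step; have le := connect1 step; rewrite /hl /ll.
case: (bruhat_stepM ij step) => [->|/connect1 les].
  rewrite !permM tpermL tpermR tperm_mulK.
  by case: (ltngtP (u i) (u j)) (adj_neq ij) => [||/val_inj/perm_inj-> /eqP//] *;
    split; exact: bruhat_refl.
case: ifP => [ascu|/negbT]; case: ifP => [ascw|/negbT]; rewrite ?perm_leqNgt.
- by split.
- move=> descw; split; first exact: bruhat_trans les (desc_bruhat descw).
  exact: bruhat_trans (asc_bruhat ascu) les.
- move=> descu; split; first exact: bruhat_trans le (asc_bruhat ascw).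
  exact: bruhat_trans (desc_bruhat descu) le.
by split.
Qed.

(* On involutions these are the steps from [w] to [s * w] or [s * w * s]; being
   composed of one-sided steps, they are monotone for the Bruhat order. *)
Definition up w := (hl i j (hl i j w)^-1)^-1.
Definition dn w := (ll i j (ll i j w)^-1)^-1.

Lemma bruhat_up u w : bruhat u w -> bruhat (up u) (up w).
Proof.
have hlP := bruhat_homo (fun u w st => proj1 (@bruhat_hl_ll u w st)).
by move=> /hlP/bruhatV/hlP/bruhatV.
Qed.

Lemma bruhat_dn u w : bruhat u w -> bruhat (dn u) (dn w).
Proof.
have llP := bruhat_homo (fun u w st => proj2 (@bruhat_hl_ll u w st)).
by move=> /llP/bruhatV/llP/bruhatV.
Qed.

Lemma bruhat_dn_id w : bruhat (dn w) w.
Proof.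
have llP (v : 'S_n) : bruhat (ll i j v) v.
  rewrite /ll; case: ifP => [_|/negbT]; first exact: bruhat_refl.
  by rewrite perm_leqNgt => /desc_bruhat.
apply: bruhat_trans (llP w); rewrite -[X in bruhat _ X]invgK.
exact: bruhatV (llP _).
Qed.

End Simple.

(** * Involutions under the action of a simple transposition *)

Lemma involutionsE w : (w \in involutions n) = (w^-1 == w).
Proof.
rewrite inE eq_invg_mul -[w * w]/(w ^+ 2) -order_dvdn.
apply/idP/idP => [|/dvdn_leq->//]; have := order_gt0 w.
by case: #[w] => [|[|[|m]]].
Qed.

Lemma involutionsK w : w \in involutions n -> involutive w.
Proof. by rewrite involutionsE => /eqP wV x; rewrite -{1}wV permK. Qed.

Lemma involutionsV w : w \in involutions n -> w^-1 = w.
Proof. by rewrite involutionsE => /eqP. Qed.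

Lemma involutionsJ w x : (w ^ x \in involutions n) = (w \in involutions n).
Proof. by rewrite !involutionsE -conjVg (inj_eq (conjg_inj _)). Qed.

Section SimpleInvolution.
Variables i j : 'I_n.
Hypothesis ij : j = i.+1 :> nat.
Let s := tperm i j.

Lemma tpermJE w a : (w ^ s) a = s (w (s a)).
Proof. by rewrite conjgE !permM tpermV. Qed.

Lemma fixC w : w i = i -> w j = j -> s * w = w * s.
Proof. by move=> wi wj; rewrite conjgC /s tpermJ wi wj. Qed.

Lemma involutionsM w : w i = i -> w j = j ->
  (s * w \in involutions n) = (w \in involutions n).
Proof.
move=> wi wj; rewrite !involutionsE {2}fixC // invMg tpermV.
by rewrite (inj_eq (mulIg _)).
Qed.

Lemma up_fix w : w \in involutions n -> w i = i -> w j = j -> up i j w = s * w.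
Proof.
move=> Iw wi wj; rewrite /up /hl wi wj (adj_lt ij) invMg (involutionsV Iw) tpermV.
rewrite !permM wi wj tpermL tpermR (adj_gtF ij).
by rewrite invMg (involutionsV Iw) tpermV.
Qed.

(** By [tperm_adj_lt] the product [w * s] still ascends at [i] unless [w] fixes both points, so the
    second one-sided step multiplies by [s] as well. *)
Lemma up_conj w : w \in involutions n -> (w i < w j)%N ->
  ~~ ((w i == i) && (w j == j)) -> up i j w = w ^ s.
Proof.
move=> Iw asc nfix; rewrite /up /hl asc invMg (involutionsV Iw) tpermV.
rewrite !permM tperm_adj_lt // !invMg (involutionsV Iw) tpermV.
by rewrite conjgE tpermV mulgA.
Qed.

Lemma dn_fix w : w \in involutions n -> w i = j -> w j = i -> dn i j w = s * w.
Proof.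
move=> Iw wi wj; rewrite /dn /ll wi wj (adj_gtF ij).
rewrite invMg (involutionsV Iw) tpermV !permM wi wj tpermL tpermR (adj_lt ij).
by rewrite invMg (involutionsV Iw) tpermV.
Qed.

Lemma dn_conj w : w \in involutions n -> (w j < w i)%N -> w i != j ->
  dn i j w = w ^ s.
Proof.
move=> Iw desc nwi; rewrite /dn /ll (ltnNge (w i)) (ltnW desc) /=.
rewrite invMg (involutionsV Iw) tpermV.
have gt : (tperm i j (w j) < tperm i j (w i))%N.
  by rewrite tperm_adj_lt // andbC (negPf nwi).
rewrite !permM ltnNge (ltnW gt) /=.
by rewrite !invMg (involutionsV Iw) tpermV conjgE tpermV mulgA.
Qed.

Lemma card_excedances_fix w : w i = i -> w j = j ->
  #|excedances (s * w)| = #|excedances w|.+1.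
Proof.
move=> wi wj; have -> : excedances (s * w) = i |: excedances w.
  apply/setP=> a; rewrite !inE permM /s.
  case: tpermP => [->|->|/eqP/negPf-> _] //; rewrite ?eqxx ?wi ?wj ?(adj_lt ij) //.
  by rewrite ltnn eq_sym (negPf (adj_neq ij)) (adj_gtF ij).
by rewrite cardsU1 inE wi ltnn.
Qed.

(** Conjugation carries the pair [(b, w b)] to its image under [s]. This changes its order only if
    [b] and [w b] are [i] and [j], which [w i != j] excludes. *)
Lemma card_excedances_conj w : w \in involutions n -> w i != j ->
  #|excedances (w ^ s)| = #|excedances w|.
Proof.
move=> Iw nwi; have nwj : w j != i.
  by rewrite -(inj_eq (@perm_inj _ w)) involutionsK // eq_sym.
have sK : involutive s by move=> a; rewrite /s tpermK.
rewrite -(on_card_preimset (f := s) (R := excedances w)); last first.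
  exact/onW_bij/inv_bij.
congr #|pred_of_set _|; apply/setP=> a; rewrite !inE tpermJE -{1}(sK a) /s.
move: (tperm i j a) => b.
case: (ltngtP b (w b)) => [lt|lt|/val_inj <-]; last by rewrite ltnn.
  by rewrite tperm_adj_lt //; apply: contra nwi => /andP[/eqP<- /eqP->].
apply/negbTE; rewrite -leqNgt ltnW // tperm_adj_lt //.
by apply: contra nwj => /andP[/eqP e /eqP<-]; rewrite e.
Qed.

(** If [w] fixes [i] and [j], the step adds one inversion and one excedance. Otherwise it is a
    conjugation, which adds two inversions and keeps the number of excedances. *)
Lemma upP w : w \in involutions n -> (w i < w j)%N ->
  [/\ up i j w \in involutions n, (up i j w j < up i j w i)%N,
      dn i j (up i j w) = w &
      #|inversions (up i j w)| + #|excedances (up i j w)|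
        = (#|inversions w| + #|excedances w|).+2].
Proof.
move=> Iw asc; have [/andP[/eqP wi /eqP wj]|nfix] := boolP ((w i == i) && (w j == j)).
  have Isw : s * w \in involutions n by rewrite involutionsM.
  have [swi swj] : (s * w) i = j /\ (s * w) j = i.
    by rewrite !permM /s tpermL tpermR.
  rewrite up_fix // dn_fix // swi swj adj_lt // tperm_mulK; split=> //.
  by rewrite card_inversions_asc // card_excedances_fix // addnS addSn.
have nwi : w i != j.
  apply: contraL asc => /eqP wi; have wj : w j = i by rewrite -wi involutionsK.
  by rewrite wi wj adj_gtF.
have IsJ : w ^ s \in involutions n by rewrite involutionsJ.
have desc : ((w ^ s)%g j < (w ^ s)%g i)%N.
  by rewrite !tpermJE /s tpermL tpermR tperm_adj_lt.
rewrite up_conj // dn_conj //; last first.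
  rewrite tpermJE /s tpermL; apply: contraNneq nwi => swj.
  rewrite -(inj_eq (@perm_inj _ w)) involutionsK // eq_sym.
  by rewrite -(inj_eq (@perm_inj _ s)) swj /s tpermL.
rewrite -conjgM tperm2 conjg1; split=> //.
rewrite card_excedances_conj // -!addSn; congr (_ + _)%N; rewrite conjgE tpermV.
have ascV : ((w * s)%g i < (w * s)%g j)%N by rewrite !permM tperm_adj_lt.
rewrite (card_inversions_asc ij) //; congr _.+1.
rewrite -[in RHS](card_inversions_asc ij asc) -[RHS]card_inversionsV invMg.
by rewrite (involutionsV Iw) tpermV.
Qed.

Lemma dn_asc w : w \in involutions n -> (w i < w j)%N -> dn i j w = w.
Proof. by move=> Iw asc; rewrite /dn /ll asc (involutionsV Iw) asc involutionsV. Qed.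

Lemma dnP w : w \in involutions n -> (w j < w i)%N ->
  [/\ dn i j w \in involutions n, (dn i j w i < dn i j w j)%N &
      up i j (dn i j w) = w].
Proof.
move=> Iw desc; have [wi|nwi] := eqVneq (w i) j.
  have wj : w j = i by rewrite -wi involutionsK.
  have [swi swj] : (s * w) i = i /\ (s * w) j = j.
    by rewrite !permM /s tpermL tpermR.
  have Isw : s * w \in involutions n by rewrite -involutionsM // tperm_mulK.
  by rewrite dn_fix // up_fix // swi swj adj_lt // tperm_mulK.
have asc : ((w ^ s)%g i < (w ^ s)%g j)%N.
  by rewrite !tpermJE /s tpermL tpermR tperm_adj_lt // andbC (negPf nwi).
rewrite dn_conj // up_conj ?involutionsJ //; last first.
  rewrite !tpermJE /s tpermL tpermR; apply: contraL desc => /andP[/eqP ej /eqP ei].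
  have -> : w i = i by apply: (@perm_inj _ (tperm i j)); rewrite ei tpermL.
  by rewrite [w j](@perm_inj _ (tperm i j) _ j) ?(adj_gtF ij) // ej tpermR.
by rewrite -conjgM tperm2 conjg1.
Qed.

Lemma involutions_dn w : w \in involutions n -> dn i j w \in involutions n.
Proof.
move=> Iw; have [asc|] := boolP (w i < w j)%N; first by rewrite dn_asc.
by rewrite perm_leqNgt // => /(dnP Iw)[].
Qed.

End SimpleInvolution.

End Bruhat.

(** * Boolean involutions and supports *)

Section Support.
Local Open Scope nat_scope.
Local Open Scope group_scope.
Variable n : nat.
Implicit Types (i j a b c p q : 'I_n) (u v w : 'S_n).

(* The simple transposition of [c] and [c + 1] lies below [w] iff [w] does not
   preserve [{0, ..., c}]. *)
Definition supp w : {set 'I_n} :=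
  [set c : 'I_n | [exists a : 'I_n, (a <= c) && (c < w a)]].

(** If no point crosses [c] upwards, [w] maps the finite set [{0, ..., c}] into itself, hence onto
    itself, so no point crosses downwards either. *)
Lemma suppPn c w : reflect (forall a, (w a <= c) = (a <= c)) (c \notin supp w).
Proof.
rewrite inE negb_exists; apply: (iffP forallP) => [cw | cw a]; last first.
  by rewrite -cw ltnNge andbN.
pose A := [set a : 'I_n | a <= c].
have wA : w @: A = A.
  apply/eqP; rewrite eqEcard card_imset ?leqnn ?andbT; last exact: perm_inj.
  apply/subsetP=> _ /imsetP[a /[!inE] ac ->].
  by have := cw a; rewrite ac -leqNgt.
move=> a; have: (w a \in w @: A) = (a \in A) by rewrite mem_imset //; apply: perm_inj.
by rewrite wA !inE.
Qed.

Lemma supp1 : supp 1 = set0.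
Proof. by apply/setP=> c; rewrite in_set0; apply/negbTE/suppPn=> a; rewrite perm1. Qed.

Lemma suppM c u v : c \notin supp u -> c \notin supp v -> c \notin supp (u * v).
Proof. by move=> /suppPn cu /suppPn cv; apply/suppPn=> a; rewrite permM cv cu. Qed.

Lemma suppV w : supp w^-1 = supp w.
Proof.
have le v c : c \notin supp v -> c \notin supp v^-1.
  by move/suppPn=> cv; apply/suppPn=> a; rewrite -cv permKV.
apply/setP=> c; apply/idP/idP; apply: contraLR => /le //.
by rewrite invgK.
Qed.

Lemma supp_tpermN p q c : ~~ (p <= c < q)%N -> (p <= q)%N -> c \notin supp (tperm p q).
Proof. by move=> pcq pq; apply/suppPn=> a; case: tpermP => [->|->|//]; lia. Qed.

(** Let a step exchange positions [p <= c < q] of [u]. If the result preserved [{0, ..., c}], then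
    [u q <= c < u p], against the ascent. So [c] can be missing from the larger support only if the
    reflection preserves [{0, ..., c}] too. *)
Lemma supp_bruhat u w : bruhat u w -> supp u \subset supp w.
Proof.
case/connectP=> s; elim: s u => [u _ -> //|v s IHs u /=] /andP[st ps /(IHs v ps)].
apply: subset_trans; case/bruhat_stepP: st => p [q [ltpq ltu ->]].
apply/subsetP=> c; apply: contraLR => ct.
have [/andP[pc cq]|npcq] := boolP (p <= c < q)%N; last first.
  by rewrite -(tperm_mulK p q u) suppM // supp_tpermN // ltnW.
move/suppPn: ct => ct; have := ct p; have := ct q.
by rewrite !permM tpermL tpermR; lia.
Qed.

Section Simple.
Variables i j : 'I_n.
Hypothesis ij : j = i.+1 :> nat.

Lemma supp_simple c : c \in supp (tperm i j) = (c == i).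
Proof.
apply/idP/eqP => [|->]; last first.
  by rewrite inE; apply/existsP; exists i; rewrite tpermL leqnn adj_lt.
by apply: contraTeq; rewrite -val_eqE /= => nci; apply: supp_tpermN; lia.
Qed.

Lemma suppN_asc w : i \notin supp w -> (w i < w j)%N.
Proof. by move/suppPn=> iw; have := iw i; have := iw j; lia. Qed.

Lemma supp_mul_out c w : c != i ->
  (c \in supp (tperm i j * w)) = (c \in supp w).
Proof.
move=> nci; have cs : c \notin supp (tperm i j) by rewrite supp_simple.
apply/idP/idP; apply: contraLR => cw; first exact: suppM.
by rewrite -(tperm_mulK i j w) suppM.
Qed.

Lemma supp_up_out c w : c != i -> (c \in supp (up i j w)) = (c \in supp w).
Proof.
move=> nci; rewrite /up /hl suppV; do 2![case: ifP => _];
  by rewrite ?supp_mul_out // suppV ?supp_mul_out.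
Qed.

Lemma supp_dn_out c w : c != i -> (c \in supp (dn i j w)) = (c \in supp w).
Proof.
move=> nci; rewrite /dn /ll suppV; do 2![case: ifP => _];
  by rewrite ?supp_mul_out // suppV ?supp_mul_out.
Qed.

(** [up i j w] descends at [i], which is impossible for a permutation without [i] in its support. *)
Lemma supp_up w : w \in involutions n -> i \notin supp w ->
  supp (up i j w) = i |: supp w.
Proof.
move=> Iw iw; apply/setP=> c; rewrite in_setU1.
have [->|nci] := eqVneq c i; last exact: supp_up_out.
have [_ desc _ _] := upP ij Iw (suppN_asc iw).
by apply: contraLR desc => /suppN_asc; rewrite -leqNgt => /ltnW.
Qed.

End Simple.

(** A step [dn] at a descent lowers [inv + exc] by two and removes at most the index [i] from the
    support. *)
Lemma leq_supp w : w \in involutions n ->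
  (#|supp w|.*2 <= #|inversions w| + #|excedances w|)%N.
Proof.
have [m] := ubnP (#|inversions w| + #|excedances w|).
elim: m => // m IHm in w * => ltm Iw.
have [->|/desc_ex[i [j [ij desc]]]] := eqVneq w 1; first by rewrite supp1 cards0.
have [Iv asc upv] := dnP ij Iw desc.
have [_ _ _] := upP ij Iv asc; rewrite upv => eq_rk.
have := IHm (dn i j w); rewrite eq_rk in ltm *; rewrite -ltnS ltnW // => /(_ isT Iv).
suff : (#|supp w| <= #|supp (dn i j w)|.+1)%N by lia.
apply: (@leq_trans #|i |: supp (dn i j w)|); last first.
  by rewrite cardsU1; case: (_ \in _) => //=; lia.
apply/subset_leq_card/subsetP=> c; rewrite in_setU1 => cw.
by have [//|nci] := eqVneq c i; rewrite supp_dn_out.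
Qed.

(** Equality in [leq_supp]: the letters of a reduced word for the action on involutions are
    distinct. [booleanP] identifies these with the Boolean involutions. *)
Definition tight w := (w \in involutions n) &&
  (#|inversions w| + #|excedances w| == #|supp w|.*2)%N.

Lemma tight_up i j w : j = i.+1 :> nat -> w \in involutions n ->
  i \notin supp w -> tight (up i j w) = tight w.
Proof.
move=> ij Iw iw; have [Iu _ _ eq_rk] := upP ij Iw (suppN_asc ij iw).
by rewrite /tight Iu Iw eq_rk supp_up // cardsU1 iw doubleS !eqSS.
Qed.

(** If [i] stayed in the support, [dn] would keep the support and lower [inv + exc] by two, against
    [leq_supp]. *)
Lemma tight_desc i j w : j = i.+1 :> nat -> tight w -> (w j < w i)%N ->
  i \notin supp (dn i j w) /\ tight (dn i j w).
Proof.
move=> ij /[dup] Gw /andP[Iw /eqP rkw] desc.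
have [Iv asc upv] := dnP ij Iw desc.
suff iv : i \notin supp (dn i j w) by rewrite -(tight_up ij Iv iv) upv.
apply/negP => iv; have := leq_supp Iv.
have [_ _ _] := upP ij Iv asc; rewrite upv rkw.
suff -> : supp w = supp (dn i j w) by lia.
apply/setP=> c; have [->|nci] := eqVneq c i; last by rewrite supp_dn_out.
by rewrite iv (subsetP (supp_bruhat (bruhat_dn_id ij w))).
Qed.

Lemma bruhat1 w : bruhat 1 w.
Proof.
have [m] := ubnP #|inversions w|; elim: m => // m IHm in w * => ltm.
have [->|/desc_ex[i [j [ij desc]]]] := eqVneq w 1; first exact: bruhat_refl.
apply: bruhat_trans (desc_bruhat ij desc); apply: IHm.
by rewrite (card_inversions_desc ij desc) in ltm.
Qed.

Lemma simple_bruhat w : w != 1 ->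
  exists i j, j = i.+1 :> nat /\ bruhat (tperm i j) w.
Proof.
have [m] := ubnP #|inversions w|; elim: m => // m IHm in w * => ltm.
case/desc_ex=> i [j [ij desc]]; have lesw := desc_bruhat ij desc.
have [sw1|/IHm] := eqVneq (tperm i j * w) 1.
  exists i, j; split=> //; rewrite -(tperm_mulK i j w) sw1 mulg1.
  exact: bruhat_refl.
rewrite (card_inversions_desc ij desc) in ltm.
case=> // i' [j' [ij' le]]; exists i', j'; split=> //; exact: bruhat_trans lesw.
Qed.

Lemma lower_involutionsE w u :
  (u \in lower_involutions w) = (u \in involutions n) && bruhat u w.
Proof. by rewrite [LHS]in_set. Qed.

Lemma involutions1 : 1 \in involutions n.
Proof. by rewrite involutionsE invg1. Qed.

(** Induction along a descent [i] of [w]. As [i] is absent from the support of [dn i j w], the set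
    [B(w)] consists of [B(dn i j w)] and its image under [up], the latter collecting the elements
    with [i] in their support. *)
Lemma tight_lower w : tight w ->
  (forall I : {set 'I_n}, I \subset supp w ->
     exists2 u, u \in lower_involutions w & supp u = I) /\
  {in lower_involutions w &, forall u v, supp u \subset supp v -> bruhat u v}.
Proof.
have [m] := ubnP #|inversions w|; elim: m => // m IHm in w * => ltm Gw.
have [w1|/desc_ex[i [j [ij desc]]]] := eqVneq w 1.
  rewrite w1 supp1; split=> [I|u v].
    rewrite subset0 => /eqP->; exists 1; last exact: supp1.
    by rewrite lower_involutionsE involutions1 bruhat_refl.
  rewrite lower_involutionsE => /andP[_ /bruhat_leq_inversions/orP[/eqP->|]]; last first.
    by rewrite inversions1 cards0.
  by move=> *; apply: bruhat1.
have Iw : w \in involutions n by case/andP: Gw.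
have [Iw' asc upw'] := dnP ij Iw desc; have [iw' Gw'] := tight_desc ij Gw desc.
have ltw' : (#|inversions (dn i j w)| < m)%N.
  rewrite -ltnS (leq_trans _ ltm) // ltnS.
  have /bruhat_leq_inversions/orP[/eqP e|//] := bruhat_dn_id ij w.
  by move: asc; rewrite e ltnNge ltnW.
have {IHm}[surj mono] := IHm _ ltw' Gw'.
have lower_dn u : u \in lower_involutions w ->
    dn i j u \in lower_involutions (dn i j w).
  by rewrite !lower_involutionsE => /andP[Iu /(bruhat_dn ij) ->]; rewrite involutions_dn.
(* An element [u] with [i] in its support must descend at [i]. Otherwise [dn] fixes [u], and [i]
   would lie in the support of [dn i j w]. *)
have up_dn u : u \in lower_involutions w -> i \in supp u ->
    up i j (dn i j u) = u /\ supp u = i |: supp (dn i j u).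
  move=> lu iu; have := lower_dn u lu; move: lu.
  rewrite !lower_involutionsE => /andP[Iu leu] /andP[Iv /supp_bruhat lev].
  have iv : i \notin supp (dn i j u) by apply: contra iw'; apply: subsetP.
  have [ascu|] := boolP (u i < u j)%N; first by rewrite dn_asc ?iu // in iv.
  rewrite perm_leqNgt // => /(dnP ij Iu)[_ _ upv].
  by rewrite -(supp_up ij Iv iv) upv.
split=> [I sIw|u v lu lv suv].
  (* Realise [I] without [i] below [dn i j w], then restore [i] by [up] where needed. *)
  have [|u' lu' su'] := surj (I :\ i).
    apply/subsetP=> c /setD1P[nci cI]; rewrite supp_dn_out //.
    exact: (subsetP sIw).
  have [iI|niI] := boolP (i \in I); last first.
    exists u'; last by rewrite su'; apply/setDidPl; rewrite disjoint_sym disjoints1.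
    move: lu'; rewrite !lower_involutionsE => /andP[-> le] /=.
    exact: bruhat_trans le (bruhat_dn_id ij w).
  have iu' : i \notin supp u' by rewrite su' !inE eqxx.
  move: lu'; rewrite !lower_involutionsE => /andP[Iu' le].
  exists (up i j u'); last by rewrite supp_up // su' setD1K.
  have [Iu _ _ _] := upP ij Iu' (suppN_asc ij iu').
  rewrite lower_involutionsE Iu /= -upw'; exact: bruhat_up.
(* Away from [i] the supports are unchanged by [dn], and [i] is not in the support of [dn i j u], so
   the induction hypothesis applies. *)
have le_dn : bruhat (dn i j u) (dn i j v).
  apply: mono; rewrite ?lower_dn //; apply/subsetP=> c.
  have [->|nci] := eqVneq c i; last by rewrite !supp_dn_out //; apply: subsetP.
  have := lower_dn u lu; rewrite lower_involutionsE.
  case/andP=> _ /supp_bruhat/subsetP le /le.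
  by rewrite (negPf iw').
have [iu|niu] := boolP (i \in supp u).
  have [<- _] := up_dn u lu iu; have [<- _] := up_dn v lv (subsetP suv i iu).
  exact: bruhat_up.
have Iu : u \in involutions n by move: lu; rewrite lower_involutionsE => /andP[].
rewrite -(dn_asc Iu (suppN_asc ij niu)).
exact: bruhat_trans le_dn (bruhat_dn_id ij v).
Qed.

Lemma tight_boolean w : tight w -> is_boolean w.
Proof.
move=> Gw; have [surj mono] := tight_lower Gw.
pose f u := [set x : 'I_#|supp w| | enum_val x \in supp u].
have fE x u : (x \in f u) = (enum_val x \in supp u) by rewrite [LHS]in_set.
have f_sub : {in lower_involutions w &, forall u v,
    bruhat u v = (f u \subset f v)}.
  move=> u v lu lv; apply/idP/idP => [/supp_bruhat/subsetP le|/subsetP le].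
    by apply/subsetP=> x; rewrite !fE => /le.
  apply: mono => //; apply/subsetP=> c cu.
  have cw : c \in supp w.
    by move: lu; rewrite lower_involutionsE => /andP[_ /supp_bruhat/subsetP]; apply.
  by have := le (enum_rank_in cw c); rewrite !fE enum_rankK_in //; apply.
exists #|supp w|, f; split=> //.
  move=> u v lu lv fuv; apply: bruhat_anti; rewrite f_sub // fuv; exact: subxx.
apply/setP=> X; rewrite inE; apply/imsetP.
have [|u lu su] := surj (enum_val @: X).
  by apply/subsetP=> _ /imsetP[x _ ->]; apply: enum_valP.
by exists u => //; apply/setP=> x; rewrite fE su mem_imset //; apply: enum_val_inj.
Qed.

Lemma boolean_tight w : w \in involutions n -> is_boolean w -> tight w.
Proof.
move=> Iw [k [f [f_inj f_im f_sub]]].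
have lower1 : 1 \in lower_involutions w.
  by rewrite lower_involutionsE involutions1 bruhat1.
(* Along a reduced word of [u] the sets [f] grow strictly, while [inv + exc] grows by two at each
   letter. *)
have rank_f u : u \in lower_involutions w ->
    (#|inversions u| + #|excedances u| <= #|f u|.*2)%N.
  have [m] := ubnP #|inversions u|; elim: m => // m IHm in u * => ltm lu.
  have [->|/desc_ex[i [j [ij desc]]]] := eqVneq u 1.
    rewrite inversions1 cards0 (_ : excedances 1 = set0) ?cards0 //.
    by apply/setP=> a; rewrite !inE perm1 ltnn.
  move: (lu); rewrite lower_involutionsE => /andP[Iu leu].
  have [Iv asc upv] := dnP ij Iu desc; have lev := bruhat_dn_id ij u.
  have [_ _ _] := upP ij Iv asc; rewrite upv => ->.
  have lv : dn i j u \in lower_involutions w.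
    by rewrite lower_involutionsE Iv (bruhat_trans lev).
  have nvu : dn i j u != u by apply: contraTneq asc => ->; rewrite perm_leqNgt.
  have ltv : (#|inversions (dn i j u)| < m)%N.
    move/bruhat_leq_inversions: (lev); rewrite (negPf nvu) /= => lt.
    by rewrite (leq_trans lt).
  apply: leq_trans (_ : _ <= #|f (dn i j u)|.+1.*2)%N _.
    by rewrite doubleS !ltnS IHm.
  rewrite leq_double proper_card // properEneq -f_sub // lev andbT.
  by apply: contraNneq nvu => /(f_inj _ _ lv lu)->.
have f1 : f 1 = set0.
  have : set0 \in f @: lower_involutions w by rewrite f_im inE.
  by case/imsetP=> u lu fu; apply/eqP; rewrite -subset0 fu -f_sub // bruhat1.
(* [F] sends an index to the image of its simple transposition; the default [set0] covers the last
   index, which has no successor. Every singleton arises in this way from the support of [w], whence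
   [k <= #|supp w|]. *)
pose F i := if [pick j : 'I_n | j == i.+1 :> nat] is Some j
            then f (tperm i j) else set0.
have atoms : [set [set a] | a : 'I_k] \subset F @: supp w.
  apply/subsetP=> _ /imsetP[a _ ->].
  have : [set a] \in f @: lower_involutions w by rewrite f_im inE.
  case/imsetP=> u lu fu; have nu1 : u != 1.
    apply/eqP=> u1; move: fu; rewrite u1 f1 => /setP/(_ a).
    by rewrite !inE eqxx.
  have [i [j [ij lesu]]] := simple_bruhat nu1.
  have lesw : bruhat (tperm i j) w.
    by move: lu; rewrite lower_involutionsE => /andP[_]; apply: bruhat_trans.
  have ls : tperm i j \in lower_involutions w.
    by rewrite lower_involutionsE involutionsE tpermV eqxx.
  apply/imsetP; exists i.
    by rewrite (subsetP (supp_bruhat lesw)) // supp_simple.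
  rewrite /F; case: pickP => [j' /eqP ij'|/(_ j)]; last by rewrite ij eqxx.
  have -> : j' = j by apply: val_inj; rewrite /= ij' ij.
  apply/esym/eqP; move: lesu; rewrite f_sub // -fu subset1 => /orP[//|/eqP fs0].
  have /(congr1 (fun t : 'S_n => t i)) : tperm i j = 1 by apply: f_inj; rewrite ?fs0.
  by rewrite tpermL perm1 => ji; have := adj_neq ij; rewrite ji eqxx.
rewrite /tight Iw eqn_leq leq_supp // andbT.
apply: leq_trans (rank_f w _) _; first by rewrite lower_involutionsE Iw bruhat_refl.
rewrite leq_double (leq_trans (max_card _)) // card_ord.
have := subset_leq_card atoms; rewrite card_imset; last exact: set1_inj.
by rewrite card_ord => /leq_trans-> //; apply: leq_imset_card.
Qed.

Lemma booleanP w : w \in involutions n -> `[< is_boolean w >] = tight w.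
Proof.
move=> Iw; apply/asboolP/idP; [exact: boolean_tight | exact: tight_boolean].
Qed.

End Support.

(** * The recurrence *)

Section Count.
Variables (K : comNzRingType) (y z : K).

Definition weight n (w : 'S_n) : K := y ^+ #|inversions w| * z ^+ #|excedances w|.

Definition fixes n k (w : 'S_n) :=
  [forall a : 'I_n, (k <= a)%N ==> (w a == a)].

(** The sum [a_n] of the recurrence, with [tight] standing for Boolean. *)
Definition gsum n : K := \sum_(w : 'S_n | tight w) weight w.

Section Simple.
Variables (n : nat) (i j : 'I_n).
Hypothesis ij : j = i.+1 :> nat.
Implicit Types w : 'S_n.

(** Here and in [tight_conj] [w] may be any permutation, which suits reindexing: if [w] is not an
    involution, both sides are false. *)
Lemma tight_fix w : w i = i -> w j = j -> i \notin supp w ->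
  tight (tperm i j * w)%g = tight w.
Proof.
move=> wi wj iw; have := involutionsM wi wj.
have [Iw|nIw] := boolP (w \in involutions n); last by rewrite /tight (negPf nIw) => ->.
by rewrite -(tight_up ij Iw iw) up_fix.
Qed.

Lemma tight_conj w : ~~ ((w i == i) && (w j == j)) -> i \notin supp w ->
  tight (w ^ tperm i j)%g = tight w.
Proof.
move=> nfix iw; have := involutionsJ w (tperm i j).
have [Iw|nIw] := boolP (w \in involutions n); last by rewrite /tight (negPf nIw) => ->.
by rewrite -(tight_up ij Iw iw) up_conj ?suppN_asc.
Qed.

Lemma weight_fix w : w i = i -> w j = j ->
  weight (tperm i j * w)%g = y * z * weight w.
Proof.
move=> wi wj; rewrite /weight card_inversions_asc ?wi ?wj ?(adj_lt ij) //.
by rewrite card_excedances_fix // !exprS; ring.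
Qed.

Lemma weight_conj w : w \in involutions n -> ~~ ((w i == i) && (w j == j)) ->
  i \notin supp w -> weight (w ^ tperm i j)%g = y ^+ 2 * weight w.
Proof.
move=> Iw nfix iw; have asc := suppN_asc ij iw.
have nwi : w i != j.
  by have /suppPn/(_ i) := iw; rewrite leqnn -val_eqE /=; lia.
have [_ _ _] := upP ij Iw asc; rewrite up_conj // /weight.
rewrite card_excedances_conj // => /eqP; rewrite -!addSn eqn_add2r => /eqP->.
by rewrite mulrA -exprD.
Qed.

End Simple.

(** * Adding a fixed last point *)

Section LiftMax.
Variable n : nat.
Implicit Types (v : 'S_n) (w : 'S_n.+1).

Definition extend v : 'S_n.+1 := lift_perm ord_max ord_max v.

Lemma extendE v a : extend v (lift ord_max a) = lift ord_max (v a).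
Proof. exact: lift_perm_lift. Qed.

Lemma extend_max v : extend v ord_max = ord_max.
Proof. exact: lift_perm_id. Qed.

Lemma extend_inj : injective extend.
Proof.
move=> u v uv; apply/permP=> a; apply: (@lift_inj _ ord_max).
by rewrite -!extendE uv.
Qed.

Lemma extend_surj w : w ord_max = ord_max -> exists v, w = extend v.
Proof.
(* The default [a] is never taken, since [w] sends only [ord_max] to [ord_max]. *)
move=> wmax; pose f a := odflt a (unlift ord_max (w (lift ord_max a))).
have fE a : lift ord_max (f a) = w (lift ord_max a).
  rewrite /f; case: unliftP => [b -> //|]; rewrite -{2}wmax => /perm_inj/eqP.
  by rewrite eq_sym (negPf (neq_lift _ _)).
have f_inj : injective f.
  by move=> a b /(congr1 (lift ord_max)); rewrite !fE => /perm_inj/lift_inj.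
exists (perm f_inj); apply/permP=> a; case: (unliftP ord_max a) => [b|] ->.
  by rewrite extendE permE fE.
by rewrite extend_max.
Qed.

Lemma involutions_extend v :
  (extend v \in involutions n.+1) = (v \in involutions n).
Proof.
by rewrite !involutionsE /extend lift_permV (inj_eq extend_inj).
Qed.

Lemma card_inversions_extend v : #|inversions (extend v)| = #|inversions v|.
Proof.
pose f (e : 'I_n * 'I_n) : 'I_n.+1 * 'I_n.+1 := (lift ord_max e.1, lift ord_max e.2).
have f_inj : injective f.
  move=> [a b] [c d] fe; congr (_, _); apply: (@lift_inj _ ord_max).
    exact: (congr1 fst fe).
  exact: (congr1 snd fe).
rewrite -(card_imset _ f_inj); congr #|pred_of_set _|; apply/setP=> -[a b].
rewrite inE; apply/idP/imsetP => /= [|[[c d]]]; last first.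
  by rewrite inE => /= cd [-> ->]; rewrite !extendE !lift_max.
case: (unliftP ord_max a) => [c|] ->; case: (unliftP ord_max b) => [d|] ->.
- by rewrite !extendE !lift_max => cd; exists (c, d); rewrite ?inE.
- by rewrite andbC extend_max extendE !lift_max ltnNge (ltnW (ltn_ord (v c))).
- by rewrite ltnNge -ltnS ltn_ord.
by rewrite ltnn.
Qed.

Lemma card_excedances_extend v : #|excedances (extend v)| = #|excedances v|.
Proof.
rewrite -[RHS](card_imset _ (@lift_inj n.+1 ord_max)); congr #|pred_of_set _|.
apply/setP=> a; rewrite inE; case: (unliftP ord_max a) => [b|] ->.
  by rewrite extendE !lift_max (mem_imset _ _ (@lift_inj _ _)) inE.
rewrite extend_max ltnn; apply/esym/negbTE/imsetP => -[b _ /eqP].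
by rewrite (negPf (neq_lift _ _)).
Qed.

Lemma card_supp_extend v : #|supp (extend v)| = #|supp v|.
Proof.
rewrite -[RHS](card_imset _ (@lift_inj n.+1 ord_max)); congr #|pred_of_set _|.
apply/setP=> a; case: (unliftP ord_max a) => [b|] ->; last first.
  rewrite inE; apply/idP/imsetP => [/existsP[c /andP[_]]|[b _ /eqP]].
    by rewrite ltnNge -ltnS ltn_ord.
  by rewrite (negPf (neq_lift _ _)).
rewrite (mem_imset _ _ (@lift_inj _ _)) !inE.
apply/existsP/existsP => [] [c]; last first.
  by exists (lift ord_max c); rewrite extendE !lift_max.
case: (unliftP ord_max c) => [d|] ->.
  by rewrite extendE !lift_max; exists d.
by rewrite lift_max leqNgt ltn_ord.
Qed.

Lemma tight_extend v : tight (extend v) = tight v.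
Proof.
by rewrite /tight involutions_extend card_inversions_extend
  card_excedances_extend card_supp_extend.
Qed.

Lemma weight_extend v : weight (extend v) = weight v.
Proof. by rewrite /weight card_inversions_extend card_excedances_extend. Qed.

Lemma fixes_extend k v : (k <= n)%N -> fixes k (extend v) = fixes k v.
Proof.
move=> lekn; apply/forallP/forallP => fk a.
  by have := fk (lift ord_max a); rewrite extendE lift_max (inj_eq (@lift_inj _ _)).
case: (unliftP ord_max a) => [b|] ->; last by rewrite extend_max eqxx implybT.
by rewrite extendE lift_max (inj_eq (@lift_inj _ _)).
Qed.

Lemma sum_fixesS k : (k <= n)%N ->
  \sum_(w : 'S_n.+1 | tight w && fixes k w) weight w =
  \sum_(v : 'S_n | tight v && fixes k v) weight v.
Proof.
move=> lekn; pose Q := [set v : 'S_n | tight v && fixes k v].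
rewrite (eq_bigl (mem (extend @: Q))) => [|w] /=.
  rewrite big_imset /=; last by move=> u v _ _; apply: extend_inj.
  by apply: eq_big => [v|v _]; rewrite ?inE ?weight_extend.
apply/andP/imsetP => [[Gw fw]|[v]]; last first.
  by rewrite inE => /andP[Gv fv] ->; rewrite tight_extend fixes_extend.
have [|v w_v] := @extend_surj w.
  by have /forallP/(_ ord_max) := fw; rewrite lekn => /eqP.
exists v => //; rewrite w_v tight_extend fixes_extend // in Gw fw.
by rewrite inE Gw fw.
Qed.

End LiftMax.

(** Removing the fixed last points preserves tightness and weight. The size [d + k] reduces to
    successors of [k] when [d] is a numeral. *)
Lemma sum_fixes k d :
  \sum_(w : 'S_(d + k) | tight w && fixes k w) weight w = gsum k.
Proof.
elim: d => [|d IHd]; last by rewrite addSn sum_fixesS ?leq_addl.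
apply: eq_bigl => w; rewrite andb_idr // => _.
by apply/forallP=> a; rewrite leqNgt ltn_ord.
Qed.

(** * Splitting by the behaviour of the last two points *)

Section LastTwo.
Variables (n : nat) (q r : 'I_n.+2).
Hypotheses (q_n : q = n :> nat) (r_n : r = n.+1 :> nat).
Implicit Types w : 'S_n.+2.

Let qr : r = q.+1 :> nat. Proof. by rewrite q_n r_n. Qed.
Let s := tperm q r.

Lemma fixes_last w : fixes n.+1 w = (w r == r).
Proof.
apply/forallP/eqP => [/(_ r)|wr a]; first by rewrite r_n leqnn => /eqP.
apply/implyP=> lea; suff -> : a = r by rewrite wr.
by apply: val_inj; rewrite /= r_n; apply/eqP; rewrite eqn_leq lea -ltnS ltn_ord.
Qed.

Lemma fixes_last2 w : fixes n w = (w r == r) && (w q == q).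
Proof.
apply/forallP/andP => [fw|[/eqP wr /eqP wq] a].
  by have := fw r; have := fw q; rewrite r_n q_n leqnSn leqnn.
apply/implyP=> lea; have [-> | nar] := eqVneq a r; first by rewrite wr.
suff -> : a = q by rewrite wq.
by apply: val_inj; move: nar (ltn_ord a); rewrite -val_eqE /= q_n r_n; lia.
Qed.

Lemma last_suppN w : w r = r -> q \notin supp w.
Proof.
have leqE (b : 'I_n.+2) : (b <= q)%N = (b != r).
  by rewrite -val_eqE /= q_n r_n; have := ltn_ord b; lia.
move=> wr; apply/suppPn=> a; rewrite !leqE; congr (~~ _).
by rewrite -{1}wr (inj_eq perm_inj).
Qed.

(** The case left over when [r] is moved, not to [q], and [q] is not fixed; [sum_crossing] evaluates
    it from three points on. *)
Definition crossing w := [&& w r != r, w r != q & w q != q].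

Lemma gsum_last2 :
  gsum n.+2 = gsum n.+1 + (y * z * gsum n + (y ^+ 2 * (gsum n.+1 - gsum n) +
    \sum_(w : 'S_n.+2 | tight w && crossing w) weight w)).
Proof.
rewrite {1}/gsum (bigID (fun w => w r == r)) /=; congr (_ + _).
  by rewrite -(sum_fixes n.+1 1); apply: eq_bigl => w; rewrite fixes_last.
rewrite (bigID (fun w => w r == q)) /=; congr (_ + _).
  rewrite -(sum_fixes n 2) mulr_sumr (reindex_inj (mulgI s)) /=.
  have fixP w : (tight (s * w)%g && ((s * w)%g r != r)) && ((s * w)%g r == q) =
      tight w && fixes n w.
    rewrite fixes_last2 permM tpermR.
    have [wq|] := eqVneq (w q) q; last by rewrite !andbF.
    rewrite wq (adj_neq qr) !andbT.
    have [wr|nwr] := eqVneq (w r) r; first by rewrite andbT tight_fix ?last_suppN.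
    (* [s * w] sends [r] to [q]; as an involution it would send [q] back to [r], so that
       [w r = r]. *)
    rewrite andbF; apply/negP => /andP[Isw _].
    have := involutionsK Isw r; rewrite !permM tpermR wq tpermL => wr.
    by rewrite wr eqxx in nwr.
  apply: eq_big => [w|w]; rewrite fixP // fixes_last2.
  by case/and3P=> _ /eqP wr /eqP wq; apply: weight_fix.
rewrite (bigID (fun w => w q == q)) /=; congr (_ + _); last first.
  by apply: eq_bigl => w; rewrite /crossing -!andbA.
(* The difference counts the tight involutions that fix [r] but move [q]; conjugation by [s] turns
   them into those that fix [q] and move [r]. *)
have -> : gsum n.+1 - gsum n =
    \sum_(w : 'S_n.+2 | tight w && ((w r == r) && (w q != q))) weight w.
  rewrite -(sum_fixes n.+1 1) -(sum_fixes n 2) (bigID (fun w => w q == q)) /=.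
  rewrite addrC -addrA [X in _ + X](_ : _ = 0) ?addr0.
    by apply: eq_bigl => w; rewrite fixes_last andbA.
  apply/eqP; rewrite subr_eq0; apply/eqP.
  by apply: eq_bigl => w; rewrite fixes_last fixes_last2 andbA.
rewrite mulr_sumr (reindex_inj (conjg_inj s)) /=.
have conjP w : [&& tight (w ^ s)%g, (w ^ s)%g r != r, (w ^ s)%g r != q
                 & (w ^ s)%g q == q] = tight w && ((w r == r) && (w q != q)).
  rewrite !tpermJE /s tpermL tpermR !(can2_eq (tpermK q r) (tpermK q r)).
  rewrite tpermL tpermR.
  have [wr|] := eqVneq (w r) r; last by rewrite !andbF.
  have -> : w q != r by rewrite -{1}wr (inj_eq perm_inj) (adj_neq qr).
  have [nwq|] := boolP (w q != q); last by rewrite !andbF.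
  by rewrite !andbT tight_conj ?last_suppN // (negPf nwq).
apply: eq_big => [w|w Pw]; first by rewrite -conjP !andbA.
have: tight w && ((w r == r) && (w q != q)) by rewrite -conjP !andbA.
case/and3P=> /andP[Iw _] /eqP wr nwq.
by apply: weight_conj; rewrite ?last_suppN // (negPf nwq).
Qed.

End LastTwo.

(** * The crossing case on the last three points *)

Section LastThree.
Variables (n : nat) (p q r : 'I_n.+3).
Hypotheses (p_n : p = n :> nat) (q_n : q = n.+1 :> nat) (r_n : r = n.+2 :> nat).
Implicit Types w : 'S_n.+3.

Let pq : q = p.+1 :> nat. Proof. by rewrite p_n q_n. Qed.
Let qr : r = q.+1 :> nat. Proof. by rewrite q_n r_n. Qed.
Let npr : p != r. Proof. by rewrite -val_eqE /= p_n r_n; lia. Qed.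

(** Any other value of [w r] produces a descent whose letter stays in the support after [dn],
    against [tight_desc]. *)
Lemma crossing_last w : tight w -> crossing q r w -> w r = p.
Proof.
move=> Gw /and3P[nwr nwrq nwq]; have /andP[Iw _] := Gw.
have wK := involutionsK Iw.
have nwqr : w q != r by rewrite -(inj_eq (@perm_inj _ w)) wK eq_sym.
have lt_last (a : 'I_n.+3) : a != r -> a != q -> (a <= p)%N.
  by rewrite -!val_eqE /=; have := ltn_ord a; lia.
have wrp := lt_last _ nwr nwrq; have wqp := lt_last _ nwqr nwq.
have [asc|] := boolP (w q < w r)%N; last first.
  (* If [w r < w q], conjugation by [(q r)] sends [r] to [w q <= p], still across [q]. *)
  rewrite perm_leqNgt // => desc; have [] := tight_desc qr Gw desc.
  rewrite dn_conj // => /suppPn/(_ r); rewrite tpermJE tpermR.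
  by rewrite tpermD 1?eq_sym //; lia.
apply/eqP; apply: contraT; rewrite -val_eqE /= => nwrp.
(* Now [w r < p], and [w] descends from [w r] to [m] because [w (w r) = r] is the largest point.
   After conjugation by [(w r, m)] the point [w q < w r] is still sent to [q], across [w r]. *)
have ltm : ((w r).+1 < n.+3)%N by lia.
pose m := Ordinal ltm; have wr_m : m = (w r).+1 :> nat by [].
have nmr : m != r by rewrite -val_eqE /=; lia.
have desc : (w m < w (w r))%N.
  rewrite wK; have := ltn_ord (w m); rewrite ltnS leq_eqVlt r_n => /orP[/eqP e|//].
  have wm : w m = r by apply: val_inj; rewrite /= e r_n.
  by have := wK m; rewrite wm => /(congr1 (@nat_of_ord _)); rewrite wr_m; lia.
have [] := tight_desc wr_m Gw desc; rewrite (dn_conj wr_m Iw desc) ?wK 1?eq_sym //.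
move=> /suppPn/(_ (w q)); rewrite tpermJE.
have sD (a : 'I_n.+3) : (a != w r :> nat) -> (a != m :> nat) -> tperm (w r) m a = a.
  by move=> n1 n2; rewrite tpermD // -val_eqE eq_sym.
rewrite (sD (w q)) ?wK ?sD /=; lia.
Qed.

(** The bijection [g] takes the tight involutions fixing [q] and [r] but not [p] to the crossing
    ones. Its factor [(q r)] contributes [y z] and its conjugation by [(p q)] contributes [y^2]. *)
Lemma sum_crossing :
  \sum_(w : 'S_n.+3 | tight w && crossing q r w) weight w =
  y ^+ 3 * z * (gsum n.+1 - gsum n).
Proof.
have fixP w : fixes n w = [&& w r == r, w q == q & w p == p].
  apply/forallP/and3P => [fw|[/eqP wr /eqP wq /eqP wp] a].
    have := fw p; have := fw q; have := fw r.
    by rewrite p_n q_n r_n leqnn leqnSn (leq_trans (leqnSn n)).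
  apply/implyP=> lea; have [-> | nar] := eqVneq a r; first by rewrite wr.
  have [-> | naq] := eqVneq a q; first by rewrite wq.
  suff -> : a = p by rewrite wp.
  by apply: val_inj; move: nar naq (ltn_ord a); rewrite -!val_eqE /=; lia.
have -> : gsum n.+1 - gsum n = \sum_(w : 'S_n.+3
    | tight w && [&& w r == r, w q == q & w p != p]) weight w.
  rewrite -(sum_fixes n.+1 2) -(sum_fixes n 3) (bigID (fun w => w p == p)) /=.
  rewrite addrC -addrA [X in _ + X](_ : _ = 0) ?addr0.
    by apply: eq_bigl => w; rewrite (fixes_last2 q_n r_n) -!andbA.
  apply/eqP; rewrite subr_eq0; apply/eqP.
  by apply: eq_bigl => w; rewrite (fixes_last2 q_n r_n) fixP -!andbA.
have npq := adj_neq pq; have nqr := adj_neq qr.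
have tr : tperm p q r = r by rewrite tpermD // eq_sym.
have tp : tperm q r p = p by rewrite tpermD 1?eq_sym.
pose g w := ((tperm q r * w) ^ tperm p q)%g.
have g_inj : injective g by move=> u v /conjg_inj/mulgI.
have gE w a : g w a = tperm p q (w (tperm q r (tperm p q a))).
  by rewrite /g tpermJE permM.
rewrite mulr_sumr (reindex_inj g_inj) /=.
have last_tight w : w r = r -> w q = q -> w p != p ->
    [/\ q \notin supp w, p \notin supp (tperm q r * w)%g &
        ~~ (((tperm q r * w)%g p == p) && ((tperm q r * w)%g q == q))].
  move=> wr wq nwp; split; first exact: (last_suppN q_n r_n).
    apply: suppM; first by apply: supp_tpermN; lia.
    have leqE (b : 'I_n.+3) : (b <= p)%N = (b != r) && (b != q).
      by rewrite -!val_eqE /=; have := ltn_ord b; lia.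
    apply/suppPn=> a; rewrite !leqE -{1}wr -{1}wq.
    by rewrite !(inj_eq perm_inj).
  by rewrite !permM tpermL wr andbC eq_sym (negPf nqr).
have Pg w : tight (g w) && crossing q r (g w) =
    tight w && [&& w r == r, w q == q & w p != p].
  apply/idP/idP => [/andP[Gg Cg]|/andP[Gw /and3P[/eqP wr /eqP wq nwp]]].
    have gr := crossing_last Gg Cg; have /andP[Ig _] := Gg.
    have gp : g w p = r by rewrite -gr involutionsK.
    have wq : w q = q.
      apply: (@perm_inj _ (tperm p q)); rewrite tpermR -{2}gr gE.
      by rewrite tr tpermR.
    have wr : w r = r.
      by apply: (@perm_inj _ (tperm p q)); rewrite tr -{2}gp gE !tpermL.
    have nwp : w p != p.
      case/and3P: Cg => _ _; rewrite gE tpermR tp.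
      by apply: contra => /eqP->; rewrite tpermL.
    have [qw pw nfix] := last_tight w wr wq nwp.
    by move: Gg; rewrite tight_conj // tight_fix // wr wq nwp !eqxx => ->.
  have [qw pw nfix] := last_tight w wr wq nwp.
  rewrite tight_conj // tight_fix // Gw /=.
  have gr : g w r = p by rewrite gE tr tpermR wq tpermR.
  rewrite /crossing gr npr npq /= gE tpermR tp.
  by rewrite -{2}(tpermL p q) (inj_eq perm_inj).
apply: eq_big => [w|w]; rewrite Pg //.
case/andP=> Gw /and3P[/eqP wr /eqP wq nwp].
have [qw pw nfix] := last_tight w wr wq nwp.
have /andP[Iw _] := Gw.
rewrite weight_conj ?involutionsM // weight_fix //; ring.
Qed.

End LastThree.

Lemma gsum0 : gsum 0 = 1.
Proof.
rewrite /gsum (big_pred1 (1%g : 'S_0)) => [|w].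
  rewrite /weight inversions1 cards0 (_ : excedances 1 = set0) ?cards0 ?mulr1 //.
  by apply/setP=> -[].
have -> : w = 1%g by apply/permP=> -[].
rewrite /= eqxx /tight involutions1 inversions1 cards0 supp1 cards0.
by rewrite (_ : excedances 1 = set0) ?cards0 //; apply/setP=> -[].
Qed.

Lemma gsum1 : gsum 1 = 1.
Proof.
rewrite -gsum0 -(sum_fixes 0 1); apply: eq_bigl => w.
rewrite andb_idr // => _; apply/forallP=> a.
by apply/implyP=> _; rewrite !ord1.
Qed.

Lemma gsum2 : gsum 2 = 1 + y * z.
Proof.
rewrite (@gsum_last2 0 ord0 ord_max) // gsum0 gsum1 subrr mulr0 add0r mulr1.
(* On two points [w r] can only be [q] or [r], so nothing is crossing. *)
rewrite big_pred0 ?addr0 // => w; apply/negbTE; rewrite negb_and.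
rewrite /crossing; case: (w ord_max) => -[|[|//]] ltm; rewrite ?orbT //.
Qed.

Lemma gsum_rec n : gsum n.+3 = gsum n.+2 + (y * z * gsum n.+1 +
  (y ^+ 2 * (gsum n.+2 - gsum n.+1) + y ^+ 3 * z * (gsum n.+1 - gsum n))).
Proof.
have ltp : (n < n.+3)%N by lia.
have ltq : (n.+1 < n.+3)%N by lia.
rewrite (@gsum_last2 n.+1 (Ordinal ltq) ord_max) //.
by rewrite (@sum_crossing n (Ordinal ltp) (Ordinal ltq)).
Qed.

End Count.

(** * Power series *)

Section FpsCoef.
Variable R : comNzRingType.
Implicit Types (a b : fps R) (c : R).

Lemma fpscoefD a b n : fpscoef (a + b) n = fpscoef a n + fpscoef b n.
Proof. by []. Qed.

Lemma fpscoefN a n : fpscoef (- a) n = - fpscoef a n.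
Proof. by []. Qed.

Lemma fpscoef1 n : fpscoef (1 : fps R) n = (n == 0)%:R.
Proof. by case: n. Qed.

Lemma fpscoef_sum I (s : seq I) (P : pred I) (F : I -> fps R) n :
  fpscoef (\sum_(i <- s | P i) F i) n = \sum_(i <- s | P i) fpscoef (F i) n.
Proof. exact: (big_morph (fun a => fpscoef a n)). Qed.

Lemma fpscoef_varM a n :
  fpscoef (fps_var R * a) n = if n is m.+1 then fpscoef a m else 0.
Proof.
rewrite [LHS]/= big_ord_recl /= mul0r add0r; case: n => [|n]; first by rewrite big_ord0.
by rewrite big_ord_recl /= mul1r subSS subn0 big1 ?addr0 // => i _; rewrite mul0r.
Qed.

Lemma fpscoef_constM c a n : fpscoef (fps_const c * a) n = c * fpscoef a n.
Proof.
rewrite [LHS]/= big_ord_recl /= subn0 big1 ?addr0 // => i _; exact: mul0r.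
Qed.

Lemma fps_constX c k : fps_const c ^+ k = fps_const (c ^+ k).
Proof.
elim: k => // k IHk; apply: fpsP => n.
by rewrite exprS IHk fpscoef_constM exprS; case: n => //= n; rewrite mulr0.
Qed.

Lemma fpscoef_varXM k a n :
  fpscoef (fps_var R ^+ k * a) n = if (k <= n)%N then fpscoef a (n - k) else 0.
Proof.
elim: k n => [|k IHk] n; first by rewrite mul1r subn0.
by rewrite exprS -mulrA fpscoef_varM; case: n.
Qed.

End FpsCoef.

(** Coefficient 0 of [F] is 0, whereas the recurrence for [a_n] starts from [a_0 = 1]. Coefficient 3
    is therefore treated apart; in it the term with [a_1 - a_0] vanishes. *)
Lemma fps_rational (R : comUnitRingType) (b c : R) (F : fps R) :
  fpscoef F 0 = 0 -> fpscoef F 1 = 1 -> fpscoef F 2 = 1 + b * c ->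
  fpscoef F 3 = fpscoef F 2 + (b * c + b ^+ 2 * (fpscoef F 2 - 1)) ->
  (forall n, fpscoef F n.+4 = fpscoef F n.+3 + (b * c * fpscoef F n.+2 +
     (b ^+ 2 * (fpscoef F n.+3 - fpscoef F n.+2) +
      b ^+ 3 * c * (fpscoef F n.+2 - fpscoef F n.+1)))) ->
  let x := fps_var R in
  let y := fps_const b in
  let z := fps_const c in
  F = (x ^+ 2 * y * z + x - x ^+ 2 * y ^+ 2 - x ^+ 3 * y ^+ 3 * z)
      / (1 - x - x ^+ 2 * y * z - x * y ^+ 2 + x ^+ 2 * y ^+ 2
           - x ^+ 2 * y ^+ 3 * z + x ^+ 3 * y ^+ 3 * z).
Proof.
move=> F0 F1 F2 F3 F4 x y z.
have coefx a n : fpscoef (x * a) n = if n is m.+1 then fpscoef a m else 0.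
  exact: fpscoef_varM.
have coefy a n : fpscoef (y * a) n = b * fpscoef a n by exact: fpscoef_constM.
have coefz a n : fpscoef (z * a) n = c * fpscoef a n by exact: fpscoef_constM.
clearbody x y z.
pose coefE := (coefx, coefy, coefz, fpscoef1).
set N := (X in X / _); set D := (X in _ / X).
(* Products are nested one variable at a time, so that the rules in [coefE] peel them off from the
   outside. *)
have DE a n : fpscoef (D * a) n =
    fpscoef a n - fpscoef (x * a) n - fpscoef (x * (x * (y * (z * a)))) n
    - fpscoef (x * (y * (y * a))) n + fpscoef (x * (x * (y * (y * a)))) n
    - fpscoef (x * (x * (y * (y * (y * (z * a)))))) n
    + fpscoef (x * (x * (x * (y * (y * (y * (z * a))))))) n.
  by rewrite -!(fpscoefD, fpscoefN) /D; congr fpscoef; ring.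
have NE n : fpscoef N n =
    fpscoef (x * (x * (y * (z * 1)))) n + fpscoef (x * 1) n
    - fpscoef (x * (x * (y * (y * 1)))) n
    - fpscoef (x * (x * (x * (y * (y * (y * (z * 1))))))) n.
  by rewrite -!(fpscoefD, fpscoefN) /N; congr fpscoef; ring.
have unitD : D \is a GRing.unit.
  apply: fps_const_unit; rewrite -[D]mulr1 DE !coefE.
  by rewrite !(subr0, addr0) unitr1.
apply: (mulrI unitD); rewrite mulrCA divrr // mulr1.
apply: fpsP => n; rewrite DE NE.
by case: n => [|[|[|[|n]]]]; rewrite !coefE /= ?F4 ?F3 ?F2 ?F1 ?F0; ring.
Qed.

(** * Specialisation to the generating function *)

Definition rowy : fps (fps int) := fps_var (fps int).
Definition rowz : fps (fps int) := fps_const (fps_var int).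

Lemma fpscoef_weight n (w : 'S_n) i e :
  fpscoef (fpscoef (weight rowy rowz w) i) e =
  ((#|inversions w| == i) && (#|excedances w| == e))%:R.
Proof.
rewrite /weight fpscoef_varXM fps_constX.
have coef0 k : fpscoef (0 : fps int) k = 0 by [].
case: (ltngtP _ i) => [lt|gt|<-] //=; last first.
  rewrite subnn -[X in fpscoef X]mulr1 fpscoef_varXM fpscoef1.
  by rewrite subn_eq0 eqn_leq; case: (_ <= e)%N.
by rewrite -(subnSK lt).
Qed.

Lemma nb_boolean_gsum n i e :
  (nb_boolean n i e)%:Z = fpscoef (fpscoef (gsum rowy rowz n) i) e.
Proof.
rewrite /gsum 2!fpscoef_sum.
under [RHS]eq_bigr do rewrite fpscoef_weight.
rewrite -natr_sum -[LHS]natz; congr _%:R; rewrite /nb_boolean -sum1_card big_mkcond.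
rewrite [RHS]big_mkcond; apply: eq_bigr => w _; rewrite in_set.
have [Iw|nIw] := boolP (w \in involutions n); last by rewrite /tight (negPf nIw).
by rewrite booleanP //; case: (tight w) => //=; case: (_ && _).
Qed.

Lemma fpscoef_boolean_gf n : fpscoef boolean_gf n.+1 = gsum rowy rowz n.+1.
Proof.
by apply: fpsP => i; apply: fpsP => e; rewrite -nb_boolean_gsum.
Qed.

Theorem proposition4p3 :
  let x : fps3 int := varx int in
  let y : fps3 int := vary int in
  let z : fps3 int := varz int in
  boolean_gf = (x ^+ 2 * y * z + x - x ^+ 2 * y ^+ 2 - x ^+ 3 * y ^+ 3 * z)
      / (1 - x - x ^+ 2 * y * z - x * y ^+ 2 + x ^+ 2 * y ^+ 2
           - x ^+ 2 * y ^+ 3 * z + x ^+ 3 * y ^+ 3 * z).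
Proof.
have coef1 := fpscoef_boolean_gf 0; have coef2 := fpscoef_boolean_gf 1.
have coef3 := fpscoef_boolean_gf 2.
apply: (@fps_rational _ rowy rowz).
- by apply: fpsP => i; apply: fpsP => e.
- by rewrite coef1 gsum1.
- by rewrite coef2 gsum2.
- by rewrite coef3 coef2 gsum_rec gsum1 gsum0 subrr mulr0 addr0 mulr1.
by move=> n; rewrite !fpscoef_boolean_gf gsum_rec.
Qed.
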